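(* Let $\Gamma$ be a tropical curve, and let $p \in \Gamma$ be a basepoint. If we endow the Jacobian $J(\Gamma)$ with the Euclidean metric $\|\cdot\|_{L^2}$, then the image of a segment $e \subset \Gamma$ under the Abel-Jacobi map $\Phi_p: \Gamma \to J(\Gamma)$ has length $\sqrt{\ell(e)F(e)}$, where $F(e)$ is the Foster coefficient of $e$.
   Context: A weighted graph $G$ is a finite connected multigraph (loops and multiple edges allowed) with finite vertex set $V(G)\ne\emptyset$, finite edge set $E(G)$, lengths $\ell : E(G) \to \mathbb{R}_{>0}$, and an orientation: each edge $e$ has tail $e^-$ and head $e^+$. $C_1(G,A)$ is the free $A$-module on $E(G)$ ($A=\mathbb{Z}$ or $\mathbb{R}$), and $C_1(G,\mathbb{R})$ has the inner product $\langle\alpha_1,\alpha_2\rangle=\sum_e\alpha_1(e)\alpha_2(e)\ell(e)$. Let $(d^*\alpha)(x) = \sum_{e^+ = x}\alpha(e) - \sum_{e^-=x}\alpha(e)$ and $H_1(G,A) = \ker(d^* )\cap C_1(G,A)$. A 1-form $\omega = \sum_e \omega_e\, de$ (formal real combination) is harmonic if $\sum_{e^+=x}\omega_e = \sum_{e^-=x}\omega_e$ for all vertices $x$; $\Omega(G)$ is the space of harmonic 1-forms. Integration is bilinear with $\int_{e'} de = \ell(e)$ if $e=e'$, else $0$; each $\alpha\in C_1(G,\mathbb{R})$ gives $\int_\alpha\in\Omega(G)^*$, and $\alpha\mapsto\int_\alpha$ is an isomorphism $H_1(G,\mathbb{R})\cong\Omega(G)^*$. If $G'$ is obtained from $G$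 by length-preserving subdivision of edges with induced orientation (a refinement), with $e$ subdivided into $e_1,\dots,e_n$, then $r(e)=\sum e_i$ and $r_*(de)=\sum de_i$ induce isomorphisms $H_1(G,\mathbb{Z})\cong H_1(G',\mathbb{Z})$, $\Omega(G)\cong\Omega(G')$, compatible with integration. A tropical curve $\Gamma$ is a compact connected metric graph of finite total length, with a preferred model $G_0$ (a weighted graph whose geometric realization, gluing segments $[0,\ell(e)]$, is $\Gamma$); all other models are taken to have a common refinement with $G_0$. A segment of $\Gamma$ is the realization of an edge $e$ of $G_0$. $\Omega(\Gamma)\cong\Omega(G_0)$ is the direct limit of $\Omega(G)$ over models $G$, $H_1(\Gamma,\mathbb{Z})=H_1(G_0,\mathbb{Z})$ is embedded in $\Omega(\Gamma)^*$ by integration, and $J(\Gamma) = \Omega(\Gamma)^*/H_1(\Gamma,\mathbb{Z})$. Abel-Jacobi map: for $q\in\Gamma$ choose a model $G$ having $p$ and $q$ as vertices and a path $P$ in $G$ from $p$ to $q$, let $\alpha_P\in C_1(G,\mathbb{Z})$ be the signed count of traversals of each edge by $P$; $\Phi_p(q)$ is the class of $\int_{\alpha_P}\in\Omega(G)^*\cong\Omega(\Gamma)^*$ in $J(\Gamma)$. This is independent of choices and continuous. Euclidean metric: let $\pi:C_1(G,\mathbb{R})\to H_1(G,\mathbb{R})$ be orthogonal projection for $\langle\cdot,\cdot\rangle$. Put $\|\alpha\|_{L^2}=\sqrt{\langle\alpha,\alpha\rangle}$ and $\|\int_\alpha\|_{L^2}=\|\pi(\alpha)\|_{L^2}$ for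 $\alpha\in C_1(G,\mathbb{R})$; this is well defined on $\Omega(G)^*$ and independent of the model, hence defines $\|\cdot\|_{L^2}$ on $\Omega(\Gamma)^*$. The Foster coefficient of an edge $e$ is $F(e)=\max_j|a_j|$, where $\pi(e)=\sum_j a_je_j$ in the edge basis. In the unit-speed coordinate $t\in[0,\ell(e)]$ on a segment $e$, the path $t\mapsto\Phi_p(e(t))$ lifts to an affine path in $\Omega(\Gamma)^*$ from some $v$ to some $v'$; the length of $\Phi_p(e)$ is $\|v'-v\|_{L^2}$. *)

(* Defs.v *)
From HB Require Import structures.
From mathcomp Require Import all_boot all_order all_algebra.
From mathcomp Require Import generic_quotient ring_quotient.
From mathcomp Require Import boolp classical_sets reals.

Set Implicit Arguments.
Unset Strict Implicit.
Unset Printing Implicit Defensive.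

Import Order.TTheory GRing.Theory Num.Theory.

Local Open Scope ring_scope.

Record wgraph (R : realType) := WGraph {
  vertex : finType;
  edge : finType;
  tail : edge -> vertex;
  head : edge -> vertex;
  len : edge -> R;
  len_gt0 : forall e, 0 < len e;
  vertex_inhabited : (0 < #|vertex|)%N;
  wgraph_connected : forall x y : vertex,
    connect (fun u v => [exists e, (tail e == u) && (head e == v)
                                || (tail e == v) && (head e == u)]) x y
}.

Section Homology.
Context {R : realType}.
Implicit Type G : wgraph R.

(* The regular module R^o carries the vector space structure of R over itself. *)
Definition chain G := {ffun edge G -> R^o}.
Definition ichain G := {ffun edge G -> int}.
Definition form G := {ffun edge G -> R^o}.

Definition dstar G (A : zmodType) (c : {ffun edge G -> A}) :
    {ffun vertex G -> A} :=
  [ffun x => \sum_(e | head e == x) c e - \sum_(e | tail e == x) c e].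

Fact dstar_is_linear G : linear (@dstar G R^o).
Proof.
move=> a c d; apply/ffunP => x; rewrite !ffunE scalerBr.
under eq_bigr do rewrite !ffunE.
under [X in _ - X]eq_bigr do rewrite !ffunE.
by rewrite !big_split /= !scaler_sumr opprD addrACA.
Qed.
HB.instance Definition _ G :=
  GRing.isLinear.Build R (chain G) {ffun vertex G -> R^o} _ (@dstar G R^o)
    (@dstar_is_linear G).

Definition H1 G : {vspace chain G} := lker (linfun (@dstar G R^o)).

Definition H1Z G (c : ichain G) : Prop := dstar c = 0.

Definition inner G (a b : chain G) : R := \sum_e a e * b e * len e.

Definition chain_norm G (a : chain G) : R := Num.sqrt (inner a a).

(* The orthogonal projection of a onto H_1(G,R). *)
Definition orth_proj G (a : chain G) : chain G :=
  xget 0 [set b | b \in H1 G /\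
                  forall c, c \in H1 G -> inner (a - b) c = 0]%classic.

Definition edge_chain G (e : edge G) : chain G := [ffun j => (j == e)%:R].

Definition foster G (e : edge G) : R :=
  \big[Num.max/0]_(j : edge G) `|orth_proj (edge_chain e) j|.

(* Harmonic forms satisfy the same linear equations as cycles, so that the
   kernel of dstar serves for both; see harmonicP. *)
Definition harmonic G : {vspace form G} := lker (linfun (@dstar G R^o)).

Lemma harmonicP G (w : form G) :
  reflect (forall x, \sum_(e | head e == x) w e = \sum_(e | tail e == x) w e)
          (w \in harmonic G).
Proof.
rewrite memv_ker lfunE /=; apply: (iffP eqP) => [w0 x|w0].
  by apply/eqP; rewrite -subr_eq0; move/ffunP/(_ x): w0; rewrite !ffunE => ->.
by apply/ffunP => x; rewrite !ffunE w0 subrr.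
Qed.

Definition Omega G := subvs_of (harmonic G).
Definition Omega_dual G := 'Hom(Omega G, R^o).

Definition integral G (a : chain G) (w : form G) : R :=
  \sum_e a e * w e * len e.

Definition Omega_integral G (a : chain G) (w : Omega G) : R^o :=
  integral a (vsval w).

Fact Omega_integral_is_linear G (a : chain G) : linear (Omega_integral a).
Proof.
move=> k u v; rewrite /Omega_integral /integral linearP /=.
under eq_bigr do rewrite !ffunE mulrDr mulrDl.
rewrite big_split /= scaler_sumr; congr (_ + _).
by apply: eq_bigr => e _; rewrite /GRing.scale /= mulrCA -!mulrA.
Qed.
HB.instance Definition _ G (a : chain G) :=
  GRing.isLinear.Build R (Omega G) R^o _ (Omega_integral a)
    (Omega_integral_is_linear a).

Definition int_chain G (a : chain G) : Omega_dual G :=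
  linfun (Omega_integral a).

Lemma int_chainE G (a : chain G) (w : Omega G) :
  int_chain a w = integral a (vsval w).
Proof. by rewrite lfunE. Qed.

Fact int_chain_is_linear G : linear (@int_chain G).
Proof.
move=> k a b; apply/lfunP => w.
rewrite add_lfunE scale_lfunE !int_chainE /integral.
under eq_bigr do rewrite !ffunE 2!mulrDl.
rewrite big_split /= scaler_sumr; congr (_ + _).
by apply: eq_bigr => e _; rewrite /GRing.scale /= -!mulrA.
Qed.
HB.instance Definition _ G :=
  GRing.isLinear.Build R (chain G) (Omega_dual G) _ (@int_chain G)
    (@int_chain_is_linear G).

(* (linfun f)^-1%VF is a linear section of f over its image: it picks a chain
   a with phi = int_chain a. *)
Definition dual_norm G (phi : Omega_dual G) : R :=
  chain_norm (orth_proj ((linfun (@int_chain G))^-1%VF phi)).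

Definition realchain G (c : ichain G) : chain G := [ffun e => (c e)%:~R].

Definition period_lattice G : {pred Omega_dual G} :=
  fun phi => `[< exists c : ichain G, H1Z c /\ phi = int_chain (realchain c) >].

Fact period_lattice_zmod_closed G : zmod_closed (@period_lattice G).
Proof.
split=> [|_ _ /asboolP[c [Hc ->]] /asboolP[d [Hd ->]]]; apply/asboolP.
  exists 0; split; last first.
    rewrite -[LHS](linear0 (@int_chain G)); congr int_chain.
    by apply/ffunP => e; rewrite !ffunE.
  apply/ffunP => x; rewrite !ffunE.
  by rewrite !big1 ?subrr // => e _; rewrite ffunE.
exists (c - d); split; last first.
  rewrite -linearB /=; congr int_chain.
  by apply/ffunP => e; rewrite !ffunE intrB.
apply/ffunP => x; move: Hc Hd => /ffunP/(_ x) + /ffunP/(_ x).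
rewrite !ffunE => Hc Hd.
under eq_bigr do rewrite !ffunE.
under [X in _ - X]eq_bigr do rewrite !ffunE.
by rewrite !sumrB opprD addrACA -opprD Hc Hd subrr.
Qed.
HB.instance Definition _ G :=
  GRing.isZmodClosed.Build (Omega_dual G) (@period_lattice G)
    (@period_lattice_zmod_closed G).

Definition Jacobian G := Quotient.quot (@period_lattice G).
Definition jac_class G (phi : Omega_dual G) : Jacobian G :=
  (\pi_(Jacobian G) phi)%qT.

End Homology.

Section Paths.
Context {R : realType}.
Implicit Type G : wgraph R.

(* An edge traversed forwards (true) or backwards (false). *)
Definition dart G := (edge G * bool)%type.
Definition dsource G (a : dart G) := if a.2 then tail a.1 else head a.1.
Definition dtarget G (a : dart G) := if a.2 then head a.1 else tail a.1.

Fixpoint walk G (x : vertex G) (P : seq (dart G)) (y : vertex G) : bool :=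
  if P is a :: P' then (dsource a == x) && walk (dtarget a) P' y else x == y.

Definition chain_of_walk G (P : seq (dart G)) : ichain G :=
  [ffun e => (count_mem (e, true) P)%:Z - (count_mem (e, false) P)%:Z].

End Paths.

Section Models.
Context {R : realType}.
Implicit Type G : wgraph R.

(* G' refines G: the edge e of G is cut into the edges rf_sub e of G', listed
   from the tail of e to its head.  The last two fields say that every edge of
   G' occurs exactly once in these lists, and that every vertex of G' is either
   the image of exactly one vertex of G or an inner vertex of exactly one
   subdivided edge. *)
Record refinement (G G' : wgraph R) := Refinement {
  rf_vertex : vertex G -> vertex G';
  rf_sub : edge G -> seq (edge G');
  rf_walk : forall e, walk (rf_vertex (tail e))
                           [seq (f, true) | f <- rf_sub e]
                           (rf_vertex (head e));
  rf_len : forall e, \sum_(f <- rf_sub e) len f = len e;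
  rf_edges : perm_eq (flatten [seq rf_sub e | e <- enum (edge G)])
                     (enum (edge G'));
  rf_vertices :
    perm_eq ([seq rf_vertex v | v <- enum (vertex G)] ++
             flatten [seq behead [seq tail f | f <- rf_sub e]
                     | e <- enum (edge G)])
            (enum (vertex G'))
}.

(* r_*(de) is the sum of the df for f in rf_sub r e; by rf_edges the sum below
   has exactly one term. *)
Definition refine_form G G' (r : refinement G G') (w : form G) : form G' :=
  [ffun f => \sum_(e | f \in rf_sub r e) w e].

(* The tropical curve with preferred model G is the geometric realization of
   G.  Its points are represented without gluing: a vertex of G, or (e, t) with
   0 < t < len e, the point at distance t from the tail of e. *)
Definition point G :=
  (vertex G + {x : edge G * R | 0 < x.2 < len x.1})%type.

(* The unit-speed parametrization of the segment e by [0, len e]. *)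
Definition segment G (e : edge G) (t : R) : point G :=
  if insub (e, t) is Some x then inr x
  else if t <= 0 then inl (tail e) else inl (head e).

(* The vertex x of the refinement lies at the point q. *)
Definition vertex_at G G' (r : refinement G G') (x : vertex G') (q : point G) :
    Prop :=
  match q with
  | inl v => x = rf_vertex r v
  | inr u => exists s1 f s2,
      [/\ rf_sub r (val u).1 = s1 ++ f :: s2, x = tail f
        & \sum_(g <- s1) len g = (val u).2]
  end.

(* A model of the tropical curve with preferred model G. *)
Record model (G : wgraph R) := Model {
  model_graph : wgraph R;
  model_common : wgraph R;
  model_ref : refinement model_graph model_common;
  preferred_ref : refinement G model_common
}.

Definition model_vertex_at G (M : model G) (x : vertex (model_graph M))
    (q : point G) : Prop :=
  vertex_at (preferred_ref M) (rf_vertex (model_ref M) x) q.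

(* phi and psi correspond under Omega(G)^* = Omega(M)^*, the dual of the
   isomorphism between Omega(G) and Omega(M) via their common refinement. *)
Definition dual_corresp G (M : model G) (phi : Omega_dual G)
    (psi : Omega_dual (model_graph M)) : Prop :=
  forall (w : Omega G) (w' : Omega (model_graph M)),
    refine_form (preferred_ref M) (vsval w) =
      refine_form (model_ref M) (vsval w') ->
    phi w = psi w'.

Definition abel_jacobi G (p q : point G) : Jacobian G :=
  xget 0 [set j | exists (M : model G) (x y : vertex (model_graph M))
                    (P : seq (dart (model_graph M))) (phi : Omega_dual G),
    [/\ model_vertex_at x p, model_vertex_at y q, walk x P y,
        dual_corresp phi (int_chain (realchain (chain_of_walk P)))
      & j = jac_class phi]]%classic.

(* The straight path from v to v' in Omega^*, parametrized by [0, len e], lifts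
   the image of the segment e under the Abel-Jacobi map. *)
Definition affine_lift G (p : point G) (e : edge G) (v v' : Omega_dual G) :
    Prop :=
  forall t : R, 0 <= t <= len e ->
    jac_class (v + (t / len e) *: (v' - v)) = abel_jacobi p (segment e t).

End Models.

(* Main.v *)
Require Import Defs.
From mathcomp Require Import all_boot all_order all_algebra.
From mathcomp Require Import reals.
From mathcomp Require Import generic_quotient ring_quotient.
From mathcomp Require Import boolp classical_sets.
From mathcomp Require Import ring lra.

Set Implicit Arguments.
Unset Strict Implicit.
Unset Printing Implicit Defensive.

(* head and tail are to denote the ends of an edge, not operations on lists. *)
Import Defs.
Import Order.TTheory GRing.Theory Num.Theory.
Local Open Scope ring_scope.

(** Let [pi] be the orthogonal projection onto the cycle space.

    Along the segment [e] the Abel-Jacobi map moves with constant velocity: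
    when [t] runs from 0 to [len e], a lift of its value to the dual of the
    harmonic forms moves by [t / len e] times integration along the whole of
    [e].  Hence some affine lift has displacement [int_chain (edge_chain e)]
    ([affine_lift_exists]), and every affine lift has this displacement,
    because a difference of two lifts, moving affinely inside the discrete
    period lattice, stays constant ([affine_lift_unique]).  The length of the
    image is therefore the norm of [pi e].

    The square of this norm is [<pi e, pi e> = <e, pi e>], that is, [len e]
    times the coefficient [b e] of [b := pi e] on [e] itself.  It remains to see
    that [b e] is the largest absolute value of a coefficient of [b], hence the
    Foster coefficient ([foster_orth_proj]).  In electrical terms [b] is a
    current: [edge_chain e - b] is orthogonal to all cycles, so it is the
    gradient of a potential [h] ([orthogonal_potential]), and off [e] the
    current [b] runs from higher to lower [h].  Cut the graph at a level of [h]
    crossed by an edge [j <> e].  The net current through the cut vanishes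
    ([cycle_cut]), while all edges other than [e] that cross it carry current in
    the same direction; so [e] has to carry back at least [`|b j|].

    Computing the Abel-Jacobi map itself needs that its value depends neither on
    the model nor on the path.  The point is that a cycle on a refinement is
    constant along each subdivided edge, so that it comes from a cycle of
    the original graph ([cycle_descends]).  Over the integers this shows that
    two paths with the same ends in a refinement differ by a period; over the
    reals it identifies the harmonic forms of two models.  The result is
    [abel_jacobiE], a formula on the preferred model: points inside an edge
    contribute the piece of the edge that leads to them ([stub]), and the rest
    is an integral chain joining two vertices.  A model with both points as
    vertices is obtained by cutting each edge at two places
    ([common_subdivision]). *)

(** * Chains, boundaries and walks *)

Section Boundary.
Context {R : realType}.
Implicit Type G : wgraph R.

Definition vertex_indic G (x : vertex G) : {ffun vertex G -> int} :=
  [ffun z => (z == x)%:R].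

Lemma dstar_sum G (A : zmodType) (c : {ffun edge G -> A}) x :
  dstar c x = \sum_e (c e *+ (head e == x) - c e *+ (tail e == x)).
Proof.
rewrite ffunE sumrB.
by congr (_ - _); rewrite big_mkcond; apply: eq_bigr => e _; case: eqP.
Qed.

Lemma dstarD G (A : zmodType) (c d : {ffun edge G -> A}) :
  dstar (c + d) = dstar c + dstar d.
Proof.
apply/ffunP => x; rewrite [in RHS]ffunE !dstar_sum -big_split /=.
by apply: eq_bigr => e _; rewrite ffunE !mulrnDl opprD addrACA.
Qed.

Lemma dstarN G (A : zmodType) (c : {ffun edge G -> A}) :
  dstar (- c) = - dstar c.
Proof.
apply/ffunP => x; rewrite [in RHS]ffunE !dstar_sum -sumrN.
by apply: eq_bigr => e _; rewrite ffunE !mulNrn opprB opprK addrC.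
Qed.

Lemma dstarB G (A : zmodType) (c d : {ffun edge G -> A}) :
  dstar (c - d) = dstar c - dstar d.
Proof. by rewrite dstarD dstarN. Qed.

Lemma H1P G (c : chain G) : reflect (dstar c = 0) (c \in H1 G).
Proof. by rewrite memv_ker lfunE; apply: eqP. Qed.

Lemma realchain0 G : realchain (0 : ichain G) = 0.
Proof. by apply/ffunP => e; rewrite !ffunE. Qed.

Lemma realchainD G (c d : ichain G) :
  realchain (c + d) = realchain c + realchain d.
Proof. by apply/ffunP => e; rewrite !ffunE intrD. Qed.

Lemma realchainB G (c d : ichain G) :
  realchain (c - d) = realchain c - realchain d.
Proof. by apply/ffunP => e; rewrite !ffunE intrB. Qed.

Lemma dstar_realchain G (c : ichain G) x :
  dstar (realchain c) x = (dstar c x)%:~R.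
Proof.
rewrite !dstar_sum raddf_sum /=; apply: eq_bigr => e _.
by rewrite ffunE intrB !rmorphMn.
Qed.

Lemma realchain_H1 G (c : ichain G) : H1Z c -> realchain c \in H1 G.
Proof.
by move=> c0; apply/H1P/ffunP => x; rewrite dstar_realchain c0 !ffunE.
Qed.

Definition dart_chain G (a : dart G) : ichain G :=
  [ffun e => (-1) ^+ (~~ a.2) *+ (e == a.1)].

Lemma realchain_dart_chain G (e : edge G) :
  realchain (dart_chain (e, true)) = edge_chain e.
Proof. by apply/ffunP => i; rewrite !ffunE /=; case: eqP. Qed.

Lemma chain_of_walk_cons G (a : dart G) P :
  chain_of_walk (a :: P) = dart_chain a + chain_of_walk P.
Proof.
apply/ffunP => e; rewrite !ffunE /=; case: a => f b.
rewrite !xpair_eqE (eq_sym f); case: (e == f); case: b => /=.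
- by rewrite add0n PoszD addrA.
- by rewrite add0n PoszD opprD addrCA.
- by rewrite mulr0n add0r.
by rewrite mulr0n add0r.
Qed.

Lemma chain_of_walk_nil G : chain_of_walk ([::] : seq (dart G)) = 0.
Proof. by apply/ffunP => e; rewrite !ffunE. Qed.

Lemma dstar_dart_chain G (a : dart G) :
  dstar (dart_chain a) = vertex_indic (dtarget a) - vertex_indic (dsource a).
Proof.
apply/ffunP => x; rewrite dstar_sum (bigD1 a.1) //= big1 => [|e /negPf ne].
  rewrite !ffunE eqxx addr0 /dtarget /dsource !(eq_sym x) mulr1n.
  by case: a.2; rewrite //= expr1 !mulNrn opprK addrC.
by rewrite ffunE ne !mul0rn subrr.
Qed.

Lemma dstar_walk G (P : seq (dart G)) x y :
  walk x P y -> dstar (chain_of_walk P) = vertex_indic y - vertex_indic x.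
Proof.
elim: P x => [|a P IH] x /=.
  by move/eqP->; rewrite chain_of_walk_nil -(subrr 0) dstarB !subrr.
case/andP => /eqP<- /IH d; rewrite chain_of_walk_cons dstarD d dstar_dart_chain.
by rewrite addrC subrKA.
Qed.

Lemma walk_exists G (x y : vertex G) : exists P : seq (dart G), walk x P y.
Proof.
have /connectP[p + ->] := wgraph_connected x y; elim: p x => [|z p IH] x /=.
  by exists [::]; rewrite /= eqxx.
case/andP => /existsP[e He] /IH[P HP].
case/orP: He => /andP[/eqP ex /eqP ez].
  by exists ((e, true) :: P); rewrite /= /dsource /dtarget /= ex ez eqxx.
by exists ((e, false) :: P); rewrite /= /dsource /dtarget /= ex ez eqxx.
Qed.

Lemma bounding_chain G (x y : vertex G) :
  exists c : ichain G, dstar c = vertex_indic y - vertex_indic x.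
Proof.
by have [P /dstar_walk] := walk_exists x y; exists (chain_of_walk P).
Qed.

Lemma integralDl G (a b : chain G) w :
  integral (a + b) w = integral a w + integral b w.
Proof.
by rewrite -big_split; apply: eq_bigr => e _; rewrite ffunE !mulrDl.
Qed.

Lemma integralNl G (a : chain G) w : integral (- a) w = - integral a w.
Proof. by rewrite -sumrN; apply: eq_bigr => e _; rewrite ffunE !mulNr. Qed.

Lemma integralBl G (a b : chain G) w :
  integral (a - b) w = integral a w - integral b w.
Proof. by rewrite integralDl integralNl. Qed.

Lemma integral_chain_of_walk G (P : seq (dart G)) w :
  integral (realchain (chain_of_walk P)) w =
  \sum_(a <- P) (-1) ^+ (~~ a.2) * w a.1 * len a.1.
Proof.
elim: P => [|a P IH].
  by rewrite big_nil /integral big1 // => e _; rewrite !ffunE subrr !mul0r.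
rewrite big_cons chain_of_walk_cons realchainD integralDl IH; congr (_ + _).
rewrite /integral (bigD1 a.1) //= big1 => [|e /negPf ne].
  by rewrite !ffunE eqxx addr0 mulr1n rmorphXn rmorphN1.
by rewrite !ffunE ne !mul0r.
Qed.

End Boundary.

(** * Refinements and their cycles *)

Lemma uniq_map_inj (T U : eqType) (f : T -> U) s :
  uniq (map f s) -> {in s &, injective f}.
Proof.
elim: s => //= x s IH /andP[fx /IH inj] y z.
rewrite !inE => /predU1P[-> | ys] /predU1P[-> | zs] // fyz; last exact: inj.
  by rewrite fyz map_f in fx.
by rewrite -fyz map_f in fx.
Qed.

(** Summation by parts along a directed walk: the two ends stay, and each inner
    vertex is paired with the jump of [c] there. *)
Lemma directed_walk_sum (R : realType) (G : wgraph R) (A : zmodType)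
    (c : edge G -> A) s x y z :
  walk x [seq (f, true) | f <- s] y ->
  \sum_(f <- s) (c f *+ (head f == z) - c f *+ (tail f == z)) =
    last 0 (map c s) *+ (y == z) - seq.head 0 (map c s) *+ (x == z) +
    \sum_(q <- zip s (behead s)) (c q.1 - c q.2) *+ (tail q.2 == z).
Proof.
elim: s x => [|f s IH] x /=.
  by move=> _; rewrite !big_nil !mul0rn subrr addr0.
case/andP => /eqP <-; rewrite big_cons => w; rewrite (IH _ w).
rewrite /dsource /dtarget /=.
case: s w {IH} => [/eqP<- | g s /= /andP[/eqP gf _]].
  by rewrite /= !big_nil !mul0rn subrr !addr0.
have {gf} <- : tail g = head f := gf.
rewrite big_cons /= /dsource /= mulrnBl.
rewrite addrA [RHS]addrA addrACA [in RHS]addrACA; congr (_ + _ + _).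
by rewrite addrC.
Qed.

Lemma mem_zip_behead (T : eqType) (s : seq T) q :
  q \in zip s (behead s) -> q.1 \in s /\ q.2 \in s.
Proof.
case: s => //= x s; elim: s x => //= y s IH x.
rewrite inE => /predU1P[-> | /IH[q1 q2]] /=; first by rewrite !inE !eqxx orbT.
by rewrite q1 [_ \in [:: x, _ & _]]in_cons q2 !orbT.
Qed.

Lemma zip_behead_const (T U : eqType) (b : T -> U) u0 s :
  (forall q, q \in zip s (behead s) -> b q.1 = b q.2) ->
  forall x, x \in s -> b x = seq.head u0 (map b s).
Proof.
case: s => //= x s; elim: s x => [|y s IH] x /= c z.
  by rewrite inE => /eqP->.
rewrite inE => /predU1P[-> // | zs]; rewrite (c (x, y)) ?mem_head //=.
by apply: IH zs => q qs; apply: c; rewrite inE qs orbT.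
Qed.

Section Refinement.
Context {R : realType}.
Variables (G G' : wgraph R) (r : refinement G G').

Lemma rf_big (A : zmodType) (F : edge G' -> A) :
  \sum_f F f = \sum_e \sum_(f <- rf_sub r e) F f.
Proof.
rewrite -big_enum -(perm_big _ (rf_edges r)) big_flatten big_map big_enum.
by [].
Qed.

(** The map [r] on chains and [r_*] on forms, with any coefficients. *)
Definition refine_fun (A : zmodType) (c : {ffun edge G -> A}) :
    {ffun edge G' -> A} := [ffun f => \sum_(e | f \in rf_sub r e) c e].

Lemma refine_formE w : refine_form r w = refine_fun w. Proof. by []. Qed.

Lemma rf_sub_uniq_edge (f : edge G') e e' :
  f \in rf_sub r e -> f \in rf_sub r e' -> e = e'.
Proof.
have u : uniq (flatten [seq rf_sub r e | e <- enum (edge G)]).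
  by rewrite (perm_uniq (rf_edges r)) enum_uniq.
have /perm_to_rem pe := mem_enum (edge G) e.
move=> fe fe'; apply: contraTeq u => ne.
rewrite (perm_uniq (perm_flatten (perm_map _ pe))) /= cat_uniq.
apply/negP => /and3P[_ /negP[]]; apply/hasP; exists f => //.
apply/flatten_mapP; exists e' => //.
by rewrite mem_rem_uniq ?enum_uniq // inE eq_sym ne mem_enum.
Qed.

Lemma refine_fun_sub (A : zmodType) (c : {ffun edge G -> A}) e f :
  f \in rf_sub r e -> refine_fun c f = c e.
Proof.
move=> fe; rewrite ffunE (big_pred1 e) // => e' /=.
by apply/idP/eqP => [fe'|->//]; apply: rf_sub_uniq_edge fe' fe.
Qed.

Lemma rf_sub_exists f : exists e, f \in rf_sub r e.
Proof.
have : f \in enum (edge G') by rewrite mem_enum.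
by rewrite -(perm_mem (rf_edges r)) => /flatten_mapP[e _ fe]; exists e.
Qed.

Lemma rf_sub_neq0 e : rf_sub r e != [::].
Proof.
apply/eqP => s0; have := len_gt0 e.
by rewrite -(rf_len r e) s0 big_nil ltxx.
Qed.

(** Both arguments are constant on the pieces of an edge, whose lengths add up
    to the length of the edge. *)
Lemma integral_refine (a w : chain G) :
  integral (refine_fun a) (refine_form r w) = integral a w.
Proof.
rewrite /integral rf_big; apply: eq_bigr => e _.
rewrite -(rf_len r e) mulr_sumr !big_seq; apply: eq_bigr => f fe.
by rewrite refine_formE !(refine_fun_sub _ fe).
Qed.

Lemma refine_funD (A : zmodType) (c d : {ffun edge G -> A}) :
  refine_fun (c + d) = refine_fun c + refine_fun d.
Proof.
apply/ffunP => f; rewrite !ffunE -big_split.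
by apply: eq_bigr => e _; rewrite !ffunE.
Qed.

Lemma refine_realchain (c : ichain G) :
  refine_fun (realchain c) = realchain (refine_fun c).
Proof.
apply/ffunP => f; rewrite !ffunE raddf_sum /=.
by apply: eq_bigr => e _; rewrite ffunE.
Qed.

(** A cut, that is, a vertex of [G'] inside an edge of [G], is encoded as the
    pair of the edges of [G'] before and after it. *)
Definition rf_pairs : seq (edge G' * edge G') :=
  flatten [seq zip (rf_sub r e) (behead (rf_sub r e)) | e <- enum (edge G)].

Lemma dstar_by_parts (A : zmodType) (b : {ffun edge G' -> A}) z :
  dstar b z =
    \sum_e (last 0 (map b (rf_sub r e)) *+ (rf_vertex r (head e) == z) -
            seq.head 0 (map b (rf_sub r e)) *+ (rf_vertex r (tail e) == z)) +
    \sum_(q <- rf_pairs) (b q.1 - b q.2) *+ (tail q.2 == z).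
Proof.
rewrite dstar_sum rf_big big_flatten big_map big_enum -big_split /=.
apply: eq_bigr => e _; exact: directed_walk_sum (rf_walk r e).
Qed.

Lemma map_tail_rf_pairs :
  [seq tail q.2 | q <- rf_pairs] =
  flatten [seq behead [seq tail f | f <- rf_sub r e] | e <- enum (edge G)].
Proof.
rewrite map_flatten -map_comp; congr flatten; apply: eq_map => e /=.
rewrite (map_comp (@tail _ _) snd); case: (rf_sub r e) => //= f s.
by rewrite -/unzip2 unzip2_zip //= leqnSn.
Qed.

Lemma rf_vertices_uniq :
  uniq ([seq rf_vertex r v | v <- enum (vertex G)] ++
        [seq tail q.2 | q <- rf_pairs]).
Proof. by rewrite map_tail_rf_pairs (perm_uniq (rf_vertices r)) enum_uniq. Qed.

Lemma rf_vertex_inj : injective (rf_vertex r).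
Proof.
have := rf_vertices_uniq; rewrite cat_uniq => /andP[/dinjectiveP u _] v v' vv'.
exact: u.
Qed.

Lemma rf_vertex_not_cut v q : q \in rf_pairs -> rf_vertex r v != tail q.2.
Proof.
move=> qr; have := rf_vertices_uniq; rewrite cat_uniq => /and3P[_ /hasPn u _].
apply: contraNneq (u _ (map_f (fun q => tail q.2) qr)) => /= <-.
by rewrite map_f // mem_enum.
Qed.

Lemma refine_fun_pair (A : zmodType) (c : {ffun edge G -> A}) q :
  q \in rf_pairs -> refine_fun c q.1 = refine_fun c q.2.
Proof.
case/flatten_mapP=> e _ /mem_zip_behead[q1 q2].
by rewrite (refine_fun_sub _ q1) (refine_fun_sub _ q2).
Qed.

(** The boundary of a subdivided edge is the boundary of the edge. *)
Lemma dstar_refine (A : zmodType) (c : {ffun edge G -> A}) z :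
  dstar (refine_fun c) z =
  \sum_e (c e *+ (rf_vertex r (head e) == z) -
          c e *+ (rf_vertex r (tail e) == z)).
Proof.
rewrite dstar_by_parts [X in _ + X]big1_seq => [|q /= qr]; last first.
  by rewrite (refine_fun_pair _ qr) subrr mul0rn.
rewrite addr0; apply: eq_bigr => e _.
have fe f : f \in rf_sub r e -> refine_fun c f = c e := @refine_fun_sub _ c e f.
have -> : map (refine_fun c) (rf_sub r e) = nseq (size (rf_sub r e)) (c e).
  elim: (rf_sub r e) fe => //= f s IH fe; rewrite fe ?mem_head // IH // => g gs.
  by apply: fe; rewrite inE gs orbT.
case: (rf_sub r e) (rf_sub_neq0 e) => //= f s _; congr (_ *+ _ - _).
by elim: s.
Qed.

Lemma dstar_refine_vertex (A : zmodType) (c : {ffun edge G -> A}) v :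
  dstar (refine_fun c) (rf_vertex r v) = dstar c v.
Proof.
rewrite dstar_refine dstar_sum.
by apply: eq_bigr => e _; rewrite !(inj_eq rf_vertex_inj).
Qed.

Lemma dstar_refine_cut (A : zmodType) (c : {ffun edge G -> A}) q :
  q \in rf_pairs -> dstar (refine_fun c) (tail q.2) = 0.
Proof.
move=> qr; rewrite dstar_refine big1 // => e _.
by rewrite !(negPf (rf_vertex_not_cut _ qr)) subrr.
Qed.

Lemma rf_vertex_or_cut z :
  (exists v, z = rf_vertex r v) \/ (exists2 q, q \in rf_pairs & z = tail q.2).
Proof.
have : z \in enum (vertex G') by rewrite mem_enum.
rewrite -(perm_mem (rf_vertices r)) -map_tail_rf_pairs mem_cat.
by case/orP => /mapP[u us ->]; [left; exists u | right; exists u].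
Qed.

Lemma refine_cycle (A : zmodType) (c : {ffun edge G -> A}) :
  dstar c = 0 -> dstar (refine_fun c) = 0.
Proof.
move=> c0; apply/ffunP => z.
case: (rf_vertex_or_cut z) => [[v ->] | [q qr ->]].
  by rewrite dstar_refine_vertex c0 !ffunE.
by rewrite dstar_refine_cut // ffunE.
Qed.

(** At a cut the boundary of [b] is the jump between the edges before and after
    the cut, as no other edge ends there.  So a cycle has no jumps, hence is
    constant along each edge of [G], and it is the refinement of its values on
    the first pieces. *)
Lemma cycle_descends (A : zmodType) (b : {ffun edge G' -> A}) :
  dstar b = 0 ->
  exists2 c : {ffun edge G -> A}, dstar c = 0 & b = refine_fun c.
Proof.
move=> b0.
(* Only the term of the cut q0 survives in the boundary at that cut. *)
have bq q0 : q0 \in rf_pairs -> b q0.1 = b q0.2.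
  move=> q0r; have /ffunP/(_ (tail q0.2)) := b0.
  rewrite dstar_by_parts ffunE big1 => [|e _]; last first.
    by rewrite !(negPf (rf_vertex_not_cut _ q0r)) subrr.
  have u : uniq rf_pairs.
    by have := rf_vertices_uniq; rewrite cat_uniq => /and3P[_ _ /map_uniq].
  rewrite add0r (bigD1_seq q0) //= eqxx big_seq_cond big1 ?addr0.
    by move/eqP; rewrite mulr1n subr_eq0 => /eqP.
  move=> q /andP[qr ne]; case: eqP => // tq; case/eqP: ne.
  have := rf_vertices_uniq; rewrite cat_uniq => /and3P[_ _ uq].
  exact: uniq_map_inj uq _ _ qr q0r tq.
pose c : {ffun edge G -> A} := [ffun e => seq.head 0 (map b (rf_sub r e))].
have bc : b = refine_fun c.
  apply/ffunP => f; have [e fe] := rf_sub_exists f.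
  rewrite (refine_fun_sub _ fe) ffunE; apply: zip_behead_const fe => q qe.
  by apply: bq; apply/flatten_mapP; exists e; rewrite ?mem_enum.
exists c => //; apply/ffunP => v.
by rewrite -dstar_refine_vertex -bc b0 !ffunE.
Qed.

End Refinement.
Arguments refine_fun {R G G'} r {A}.

(** * Moving paths to the preferred model *)

Lemma walk_prefix (R : realType) (G : wgraph R) (s1 s2 : seq (edge G)) f x y :
  walk x [seq (g, true) | g <- s1 ++ f :: s2] y ->
  walk x [seq (g, true) | g <- s1] (tail f).
Proof.
elim: s1 x => [|g s1 IH] x /= /andP[]; first by rewrite eq_sym.
by move=> -> /IH.
Qed.

Section Points.
Context {R : realType}.
Implicit Type G : wgraph R.

(** Points are approached from vertices of the preferred model: [q] is reached
    from [base_vertex q] along the chain [stub q]. *)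
Definition base_vertex G (q : point G) : vertex G :=
  match q with inl v => v | inr u => tail (val u).1 end.

Definition stub G (q : point G) : chain G :=
  match q with
  | inl _ => 0
  | inr u => ((val u).2 / len (val u).1) *: edge_chain (val u).1
  end.

Lemma integral_edge_chain G (e : edge G) (k : R) w :
  integral (k *: edge_chain e) w = k * (w e * len e).
Proof.
rewrite /integral (bigD1 e) //= big1 => [|j /negPf ne].
  by rewrite !ffunE eqxx addr0 /GRing.scale /= mulr1 mulrA.
by rewrite !ffunE ne scaler0 !mul0r.
Qed.

Lemma dstar_refine_path G G' (r : refinement G G') (c : ichain G) x y :
  dstar c = vertex_indic y - vertex_indic x ->
  dstar (refine_fun r c) =
    vertex_indic (rf_vertex r y) - vertex_indic (rf_vertex r x).
Proof.
move=> dc; apply/ffunP => z.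
case: (rf_vertex_or_cut r z) => [[v ->] | [q qr ->]].
  by rewrite dstar_refine_vertex dc !ffunE !(inj_eq (@rf_vertex_inj _ _ _ r)).
rewrite dstar_refine_cut // !ffunE.
by rewrite ![tail _ == _]eq_sym !(negPf (rf_vertex_not_cut _ qr)) subrr.
Qed.

(** In a refinement having [q] as a vertex [x], the stub of [q] becomes an
    integral chain, the walk from the base vertex of [q] to [x]. *)
Lemma stub_refine G G' (r : refinement G G') x q :
  vertex_at r x q ->
  exists s : ichain G',
    dstar s = vertex_indic x - vertex_indic (rf_vertex r (base_vertex q)) /\
    forall w, integral (realchain s) (refine_form r w) = integral (stub q) w.
Proof.
case: q => [v -> | u [s1 [f [s2 [su -> len_s1]]]]] /=.
  exists 0; split=> [|w].
    by rewrite subrr -[in LHS](subrr 0) dstarB subrr.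
  by rewrite /integral !big1 // => e _; rewrite !ffunE !mul0r.
have us := rf_walk r (val u).1; rewrite su in us.
exists (chain_of_walk [seq (g, true) | g <- s1]); split=> [|w].
  exact: dstar_walk (walk_prefix us).
rewrite integral_chain_of_walk big_map integral_edge_chain.
have -> : (val u).2 / len (val u).1 * (w (val u).1 * len (val u).1) =
          w (val u).1 * (val u).2.
  by have := len_gt0 (val u).1; move=> l0; field; rewrite gt_eqF.
rewrite -len_s1 mulr_sumr !big_seq; apply: eq_bigr => g gs.
rewrite expr0 mul1r refine_formE; congr (_ * _); apply: refine_fun_sub.
by rewrite su mem_cat gs.
Qed.

(** The stubs turn [a] into a chain joining vertices of [G]; subtracting the
    refinement of a chain of [G] with the same ends leaves a cycle, to which
    [cycle_descends] applies. *)
Lemma path_descends G G' (r : refinement G G') (a : ichain G') x y p q :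
  vertex_at r x p -> vertex_at r y q ->
  dstar a = vertex_indic y - vertex_indic x ->
  exists c : ichain G,
    dstar c = vertex_indic (base_vertex q) - vertex_indic (base_vertex p) /\
    forall w, integral (realchain a) (refine_form r w) =
              integral (realchain c + stub q - stub p) w.
Proof.
move=> /stub_refine[sp [dsp Isp]] /stub_refine[sq [dsq Isq]] da.
have [c1 dc1] := bounding_chain (base_vertex p) (base_vertex q).
have cyc : dstar (a + sp - sq - refine_fun r c1) = 0.
  rewrite !dstarB dstarD da dsp dsq (dstar_refine_path _ dc1).
  by apply/ffunP => z; rewrite !ffunE; ring.
have [c2 dc2 c2E] := cycle_descends r cyc.
exists (c1 + c2); split=> [|w]; first by rewrite dstarD dc2 addr0.
rewrite integralBl integralDl -Isp -Isq -(integral_refine r).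
rewrite refine_realchain refine_funD -c2E [refine_fun r c1 + _]addrC subrK.
by rewrite realchainB realchainD integralBl integralDl subrK addrK.
Qed.

Lemma jac_class_eqP G (phi psi : Omega_dual G) :
  reflect (exists c : ichain G, H1Z c /\ phi - psi = int_chain (realchain c))
          (jac_class phi == jac_class psi).
Proof. by rewrite -Quotient.idealrBE; apply: asboolP. Qed.

Lemma int_chain_ext G (phi : Omega_dual G) (a : chain G) :
  (forall w : Omega G, phi w = integral a (vsval w)) -> phi = int_chain a.
Proof. by move=> phiE; apply/lfunP => w; rewrite int_chainE. Qed.

(** Two integral chains with the same boundary differ by a period. *)
Lemma jac_class_chain_eq G (c d : ichain G) (a : chain G) :
  dstar c = dstar d ->
  jac_class (int_chain (realchain c + a)) =
  jac_class (int_chain (realchain d + a)).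
Proof.
move=> cd; apply/eqP/jac_class_eqP; exists (c - d).
split; first by rewrite /H1Z dstarB cd subrr.
by rewrite -linearB /= realchainB opprD addrACA subrr addr0.
Qed.

End Points.

(** * Models having two given points as vertices *)

(** Every edge is cut at two places, so that the subdivided graph has simple
    vertex and edge types and two points can be dealt with at once, on the same
    edge or not. *)
Section Subdivision.
Context {R : realType} (G : wgraph R).
Variables (a b : edge G -> R).
Hypotheses (a_gt0 : forall e, 0 < a e) (lt_ab : forall e, a e < b e).
Hypothesis b_lt : forall e, b e < len e.

Let V := (vertex G + edge G * bool)%type.
Let E := (edge G * option bool)%type.

(** The pieces [None], [Some false], [Some true] of an edge follow each other;
    [(e, i)] is the tail of the piece [Some i] of [e]. *)
Definition cut_tail (f : E) : V :=
  match f with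
  | (e, None) => inl (tail e)
  | (e, Some i) => inr (e, i)
  end.
Definition cut_head (f : E) : V :=
  match f with
  | (e, None) => inr (e, false)
  | (e, Some false) => inr (e, true)
  | (e, Some true) => inl (head e)
  end.
Definition cut_len (f : E) : R :=
  match f with
  | (e, None) => a e
  | (e, Some false) => b e - a e
  | (e, Some true) => len e - b e
  end.

Lemma cut_len_gt0 f : 0 < cut_len f.
Proof. by case: f => e [[]|] //=; rewrite subr_gt0. Qed.

Lemma cut_inhabited : (0 < #|{: V}|)%N.
Proof. by rewrite card_sum addn_gt0 vertex_inhabited. Qed.

Let adj (u v : V) := [exists f, (cut_tail f == u) && (cut_head f == v)
                             || (cut_tail f == v) && (cut_head f == u)].

Lemma cut_connected (x y : V) : connect adj x y.
Proof.
have adjs : connect_sym adj.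
  apply: sym_connect_sym => u v.
  by apply: eq_existsb => f; rewrite orbC.
have adjf f : connect adj (cut_tail f) (cut_head f).
  by apply/connect1/existsP; exists f; rewrite !eqxx.
have edgec e : connect adj (inl (tail e)) (inl (head e)).
  apply: connect_trans (adjf (e, None)) _.
  exact: connect_trans (adjf (e, Some false)) (adjf (e, Some true)).
have old (u v : vertex G) : connect adj (inl u) (inl v).
  have /connectP[p + ->] := wgraph_connected u v.
  elim: p u => [|z p IH] u /=; first by rewrite connect0.
  case/andP => /existsP[e He] /IH; apply: connect_trans.
  by case/orP: He => /andP[/eqP<- /eqP<-] //; rewrite adjs.
have toold (z : V) : exists v, connect adj z (inl v).
  case: z => [v | [e i]]; first by exists v; rewrite connect0.
  exists (tail e); rewrite adjs.
  have := adjf (e, None); case: i => //= /connect_trans; apply.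
  exact: adjf (e, Some false).
have [u xu] := toold x; have [v yv] := toold y.
by apply: connect_trans xu (connect_trans (old u v) _); rewrite adjs.
Qed.

Definition subdivision : wgraph R :=
  @WGraph R V E cut_tail cut_head cut_len cut_len_gt0 cut_inhabited
    cut_connected.

Definition cut_sub (e : edge G) : seq (edge subdivision) :=
  [:: (e, None); (e, Some false); (e, Some true)].

Lemma cut_sub_len e : \sum_(f <- cut_sub e) len f = len e.
Proof. by rewrite !big_cons big_nil /=; ring. Qed.

Lemma cut_sub_walk e :
  walk (inl (tail e) : vertex subdivision) [seq (f, true) | f <- cut_sub e]
    (inl (head e)).
Proof. by rewrite /= /dsource /dtarget /= !eqxx. Qed.

Lemma cut_sub_edges :
  perm_eq (flatten [seq cut_sub e | e <- enum (edge G)])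
          (enum (edge subdivision)).
Proof.
apply: uniq_perm; rewrite ?enum_uniq //.
  apply: (@allpairs_uniq _ _ _ pair (enum (edge G))
            [:: None; Some false; Some true]) => //; first exact: enum_uniq.
  by move=> [? ?] [? ?].
move=> [e o]; rewrite mem_enum; apply/flatten_mapP.
by exists e; rewrite ?mem_enum // !inE; case: o => [[]|]; rewrite eqxx ?orbT.
Qed.

Lemma cut_sub_vertices :
  perm_eq ([seq (inl v : vertex subdivision) | v <- enum (vertex G)] ++
           flatten [seq behead [seq tail f | f <- cut_sub e]
                   | e <- enum (edge G)])
          (enum (vertex subdivision)).
Proof.
apply: uniq_perm; rewrite ?enum_uniq //.
  rewrite cat_uniq map_inj_uniq ?enum_uniq /=; last by move=> ? ? [].
  apply/andP; split.
    apply/hasPn => z /flatten_mapP[e _]; rewrite !inE.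
    by case/orP => /eqP->; apply/mapP => -[].
  apply: (@allpairs_uniq _ _ _ (fun e i => inr (e, i) : vertex subdivision)
            (enum (edge G)) [:: false; true]) => //; first exact: enum_uniq.
  by move=> [? ?] [? ?] _ _ [-> ->].
move=> z; rewrite mem_enum mem_cat; apply/orP.
case: z => [v | [e i]]; [left | right].
  by apply: map_f; rewrite mem_enum.
apply/flatten_mapP; exists e; rewrite ?mem_enum //.
by rewrite !inE; case: i; rewrite eqxx ?orbT.
Qed.

Definition subdivision_refinement : refinement G subdivision :=
  Refinement cut_sub_walk cut_sub_len cut_sub_edges cut_sub_vertices.

Lemma subdivision_vertex (q : point G) :
  (forall u, q = inr u ->
     (val u).2 = a (val u).1 \/ (val u).2 = b (val u).1) ->
  exists x, vertex_at subdivision_refinement x q.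
Proof.
case: q => [v _ | u /(_ u erefl)].
  by exists (inl v).
case=> ut; [exists (inr ((val u).1, false)) | exists (inr ((val u).1, true))].
  exists [:: ((val u).1, None)], ((val u).1, Some false),
    [:: ((val u).1, Some true)]; split=> //.
  by rewrite big_cons big_nil /= addr0 ut.
exists [:: ((val u).1, None); ((val u).1, Some false)],
  ((val u).1, Some true), [::]; split=> //.
by rewrite !big_cons big_nil /= addr0 ut addrC subrK.
Qed.

End Subdivision.

Section CommonSubdivision.
Context {R : realType}.
Implicit Type G : wgraph R.

(** The place where a cut of [e] is needed to make [q] a vertex; on edges that
    do not contain [q] the midpoint serves. *)
Definition cut_position G (q : point G) (e : edge G) : R :=
  if q is inr u then if (val u).1 == e then (val u).2 else len e / 2
  else len e / 2.

Lemma cut_position_bounds G (q : point G) e :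
  0 < cut_position q e < len e.
Proof.
have half : 0 < len e / 2 < len e by have := len_gt0 e; lra.
case: q => [//|[[f t] /= tf]] /=.
by case: eqP => // <-.
Qed.

Lemma two_cuts (s t l : R) : 0 < s < l -> 0 < t < l ->
  exists ab : R * R, [/\ 0 < ab.1, ab.1 < ab.2, ab.2 < l,
    s = ab.1 \/ s = ab.2 & t = ab.1 \/ t = ab.2].
Proof.
move=> /andP[s0 sl] /andP[t0 tl]; case: (ltgtP s t) => [st | ts | <-].
- by exists (s, t); split; auto.
- by exists (t, s); split; auto.
by exists (s, (s + l) / 2); split=> /=; auto; lra.
Qed.

Lemma common_subdivision G (p q : point G) :
  exists G' (r : refinement G G') x y, vertex_at r x p /\ vertex_at r y q.
Proof.
have cuts e := two_cuts (cut_position_bounds p e) (cut_position_bounds q e).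
have [ab abP] := choice cuts.
have a0 e : 0 < (ab e).1 by have [] := abP e.
have lt_ab e : (ab e).1 < (ab e).2 by have [] := abP e.
have bl e : (ab e).2 < len e by have [] := abP e.
have [u pu|x xp] := @subdivision_vertex _ _ _ _ a0 lt_ab bl p.
  by have [_ _ _ + _] := abP (val u).1; rewrite pu /= eqxx.
have [u qu|y yq] := @subdivision_vertex _ _ _ _ a0 lt_ab bl q.
  by have [_ _ _ _] := abP (val u).1; rewrite qu /= eqxx.
by exists (subdivision a0 lt_ab bl), (subdivision_refinement a0 lt_ab bl), x, y.
Qed.

End CommonSubdivision.

(** * The Abel-Jacobi map on the preferred model *)

Section AbelJacobi.
Context {R : realType}.
Implicit Type G : wgraph R.

Fact trivial_sub_walk G (e : edge G) :
  walk (tail e) [seq (f, true) | f <- [:: e]] (head e).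
Proof. by rewrite /= /dsource /dtarget /= !eqxx. Qed.

Fact trivial_sub_len G (e : edge G) : \sum_(f <- [:: e]) len f = len e.
Proof. by rewrite big_seq1. Qed.

Fact trivial_sub_edges G :
  perm_eq (flatten [seq [:: e] | e <- enum (edge G)]) (enum (edge G)).
Proof. by rewrite flatten_seq1. Qed.

Fact trivial_sub_vertices G :
  perm_eq ([seq v | v <- enum (vertex G)] ++
           flatten [seq behead [seq tail f | f <- [:: e]] | e <- enum (edge G)])
          (enum (vertex G)).
Proof.
by rewrite map_id; elim: (enum (edge G)) => [|e s]; rewrite /= ?cats0.
Qed.

Definition trivial_refinement G : refinement G G :=
  Refinement (@trivial_sub_walk G) (@trivial_sub_len G) (trivial_sub_edges G)
    (trivial_sub_vertices G).

Lemma refine_form_trivial G (w : form G) :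
  refine_form (trivial_refinement G) w = w.
Proof.
apply/ffunP => e; rewrite refine_formE.
by rewrite (@refine_fun_sub _ _ _ (trivial_refinement G) _ w e e) //= mem_head.
Qed.

(** Existence of the value uses the model of [common_subdivision].  For
    uniqueness, a path in any model is moved to the common refinement and from
    there to [G]; a harmonic form of [G] is matched with one of the model by
    going up to the common refinement and down by [cycle_descends]. *)
Lemma abel_jacobiE G (p q : point G) (c : ichain G) :
  dstar c = vertex_indic (base_vertex q) - vertex_indic (base_vertex p) ->
  abel_jacobi p q = jac_class (int_chain (realchain c + (stub q - stub p))).
Proof.
move=> dc; apply: xget_unique => [|j [M [x [y [P [phi [xp yq wP phiP ->]]]]]]].
  have [G' [r [x [y [xp yq]]]]] := common_subdivision p q.
  have [P wP] := walk_exists x y.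
  have [d [dd dI]] := path_descends xp yq (dstar_walk wP).
  exists (Model (trivial_refinement G') r), x, y, P,
    (int_chain (realchain d + stub q - stub p)).
  split=> //; last by rewrite -addrA; apply: jac_class_chain_eq; rewrite dc dd.
  move=> w w' /= ww'; rewrite !int_chainE -dI ww'.
  by rewrite refine_form_trivial.
have dP : dstar (refine_fun (model_ref M) (chain_of_walk P)) =
    vertex_indic (rf_vertex (model_ref M) y) -
    vertex_indic (rf_vertex (model_ref M) x).
  by apply: dstar_refine_path; apply: dstar_walk.
have [d [dd dI]] := path_descends xp yq dP.
suff -> : phi = int_chain (realchain d + (stub q - stub p)).
  by apply: jac_class_chain_eq; rewrite dc dd.
apply: int_chain_ext => w.
have /H1P/(refine_cycle (preferred_ref M)) := valP w.
move=> /(cycle_descends (model_ref M))[w' w'0 ww'].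
have w'H : w' \in harmonic (model_graph M) by apply/H1P.
rewrite (phiP w (vsproj (harmonic _) w')); last by rewrite vsprojK.
rewrite int_chainE vsprojK // addrA -dI -refine_realchain refine_formE ww'.
by rewrite -refine_formE integral_refine.
Qed.

End AbelJacobi.

(** * Orthogonal projection to the cycle space and the Foster coefficient *)

Section Projection.
Context {R : realType}.
Variable G : wgraph R.
Implicit Types a b c : chain G.

Lemma innerE a b : inner a b = integral a b. Proof. by []. Qed.

Lemma inner_sym a b : inner a b = inner b a.
Proof. by apply: eq_bigr => e _; rewrite (mulrC (a e)). Qed.

Lemma inner_edge_chainl e a : inner (edge_chain e) a = a e * len e.
Proof. by rewrite innerE -[edge_chain e]scale1r integral_edge_chain mul1r. Qed.

Lemma inner_eq0 a : inner a a = 0 -> a = 0.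
Proof.
have ge0 e : true -> 0 <= a e * a e * len e.
  by move=> _; rewrite mulr_ge0 ?(ltW (len_gt0 e)) // -expr2 sqr_ge0.
move/(psumr_eq0P ge0) => a0; apply/ffunP => e; rewrite ffunE.
move/eqP: (a0 e isT).
by rewrite mulf_eq0 (gt_eqF (len_gt0 e)) orbF mulf_eq0 orbb => /eqP.
Qed.

Lemma int_chain0 : int_chain (0 : chain G) = 0.
Proof. exact: linear0. Qed.

Lemma int_chainB a b : int_chain (a - b) = int_chain a - int_chain b.
Proof. exact: linearB. Qed.

Lemma int_chainZ k a : int_chain (k *: a) = k *: int_chain a.
Proof. exact: linearZ. Qed.

(** Harmonic forms and real cycles are the same functions on edges, so a cycle
    can be integrated against itself. *)
Lemma int_chain_eq0 a : a \in H1 G -> int_chain a = 0 -> a = 0.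
Proof.
move=> aH a0; apply: inner_eq0; have := int_chainE a (vsproj (harmonic G) a).
by rewrite a0 lfunE vsprojK // => <-.
Qed.

(** By equality of dimensions, given [int_chain_eq0]. *)
Lemma int_chain_H1_onto (phi : Omega_dual G) :
  exists2 b, b \in H1 G & phi = int_chain b.
Proof.
have : phi \in (linfun (@int_chain R G) @: H1 G)%VS.
  suff /eqP-> : (linfun (@int_chain R G) @: H1 G == fullv)%VS by rewrite memvf.
  rewrite eqEdim subvf dimvf limg_dim_eq.
    by rewrite /dim /= muln1.
  apply/eqP; rewrite -subv0; apply/subvP => a.
  rewrite memv_cap memv_ker lfunE memv0 => /andP[aH /eqP a0].
  by apply/eqP/int_chain_eq0.
by case/memv_imgP => b bH ->; exists b; rewrite ?lfunE.
Qed.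

(** [inner a c] for a cycle [c] is the integral of the form [c] along [a]; so a
    cycle defining the same functional as [a] is the projection of [a]. *)
Lemma orth_projP a :
  orth_proj a \in H1 G /\
  forall c, c \in H1 G -> inner (a - orth_proj a) c = 0.
Proof.
rewrite /orth_proj; set Q := (X in xget _ X).
suff [b /(xgetI 0)] : exists b, Q b by [].
have [b bH ab] := int_chain_H1_onto (int_chain a).
exists b; split=> // c cH; apply/eqP.
rewrite innerE integralBl subr_eq0 -(vsprojK cH) -!int_chainE.
by rewrite ab.
Qed.

Lemma orth_proj_unique a b :
  b \in H1 G -> (forall c, c \in H1 G -> inner (a - b) c = 0) ->
  orth_proj a = b.
Proof.
move=> bH ab; have [pH ap] := orth_projP a; apply/eqP; rewrite -subr_eq0.
apply/eqP/inner_eq0; have dH : orth_proj a - b \in H1 G by rewrite memvB.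
have -> : inner (orth_proj a - b) (orth_proj a - b) =
    inner (a - b) (orth_proj a - b) - inner (a - orth_proj a) (orth_proj a - b).
  rewrite !innerE -integralBl; congr integral.
  by rewrite [in RHS]opprB [RHS]addrC addrA subrK.
by rewrite ab // ap // subrr.
Qed.

(** The chain chosen in [dual_norm] has the same integrals as [a], hence the
    same inner products with cycles, hence the same projection. *)
Lemma dual_norm_int_chain a :
  dual_norm (int_chain a) = chain_norm (orth_proj a).
Proof.
rewrite /dual_norm; set a' := (_^-1)%VF _; congr chain_norm.
have aa' : int_chain a' = int_chain a.
  have := limg_lfunVK (memv_img (linfun (@int_chain R G)) (memvf a)).
  by rewrite !lfunE.
have [bH ab] := orth_projP a; apply: orth_proj_unique => // c cH.
rewrite -[RHS](ab c cH) !innerE !integralBl; congr (_ - _).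
by rewrite -(vsprojK cH) -!int_chainE aa'.
Qed.

(** The potential at [x] is the inner product of [a] with any chain from a base
    vertex to [x]: by orthogonality the choice of the chain does not matter, and
    chains to the two ends of [j] can be made to differ by [j]. *)
Lemma orthogonal_potential a :
  (forall c, c \in H1 G -> inner a c = 0) ->
  exists h : vertex G -> R, forall j, a j * len j = h (head j) - h (tail j).
Proof.
move=> a0; have /card_gt0P[x0 _] := vertex_inhabited G.
have [c cP] := choice (@bounding_chain R G x0).
exists (fun x => inner a (realchain (c x))) => j.
have /realchain_H1/a0 :
    H1Z (dart_chain (j, true) - (c (head j) - c (tail j))).
  rewrite /H1Z !dstarB dstar_dart_chain !cP /dtarget /dsource /=.
  by apply/ffunP => z; rewrite !ffunE; ring.
rewrite inner_sym innerE !realchainB !integralBl realchain_dart_chain -!innerE.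
rewrite inner_edge_chainl.
by move/subr0_eq; rewrite !(inner_sym _ a).
Qed.

(** The sum of the boundary of [b] over the vertices in [S]: edges inside [S]
    cancel. *)
Lemma cycle_cut b (S : pred (vertex G)) :
  b \in H1 G -> \sum_j (b j *+ S (head j) - b j *+ S (tail j)) = 0.
Proof.
move/H1P => b0.
have SE (v : vertex G) (k : R) : \sum_(x | S x) k *+ (v == x) = k *+ S v.
  case Sv: (S v); last first.
    by rewrite big1 // => x Sx; case: eqP => // vx; rewrite vx Sx in Sv.
  rewrite (bigD1 v) //= eqxx big1 ?addr0 // => x /andP[_].
  by rewrite eq_sym => /negPf->.
have : \sum_(x | S x) dstar b x = 0.
  by rewrite b0 big1 // => x _; rewrite ffunE.
under eq_bigr do rewrite dstar_sum.
rewrite exchange_big /= => s0; rewrite -[RHS]s0; apply: eq_bigr => j _.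
by rewrite sumrB !SE.
Qed.

Section Foster.
Variable e : edge G.
Let b := orth_proj (edge_chain e).

Lemma inner_orth_proj_edge : inner b b = b e * len e.
Proof.
have [bH /(_ b bH)] := orth_projP (edge_chain e).
rewrite innerE integralBl -!innerE inner_edge_chainl => /eqP.
by rewrite subr_eq0 => /eqP.
Qed.

Lemma orth_proj_edge_ge0 : 0 <= b e.
Proof.
rewrite -(pmulr_lge0 _ (len_gt0 e)) -inner_orth_proj_edge.
apply: sumr_ge0 => j _.
by rewrite mulr_ge0 ?(ltW (len_gt0 j)) // -expr2 sqr_ge0.
Qed.

(** The level cut described at the beginning, just above the lower end of [j]:
    [F i] is the net current that the edge [i] carries into the upper side. *)
Lemma orth_proj_edge_max j : `|b j| <= b e.
Proof.
have [-> | ne] := eqVneq j e; first by rewrite ger0_norm ?orth_proj_edge_ge0.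
have [bH /orthogonal_potential[h hP]] := orth_projP (edge_chain e).
have hb i : i != e -> h (tail i) - h (head i) = b i * len i.
  by move=> /negPf ie; rewrite -opprB -hP !ffunE ie sub0r mulNr opprK.
pose mu := Num.min (h (tail j)) (h (head j)).
pose S x := mu < h x.
have := cycle_cut S bH; rewrite -/b.
pose F i := b i *+ S (head i) - b i *+ S (tail i).
have Fle i : i != e -> F i <= 0.
  move=> /hb; rewrite /F /S => hi; have li := len_gt0 i.
  by case: (ltP mu (h (head i))); case: (ltP mu (h (tail i)));
     rewrite ?mulr1n ?mulr0n; nra.
have Fj : F j = - `|b j|.
  have := hb j ne; have lj := len_gt0 j; rewrite /F /S /mu => hj.
  case: (ltgtP (h (tail j)) (h (head j))) => hh.
  - have bj : b j < 0 by nra.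
    by rewrite ltxx hh ltr0_norm // opprK subr0.
  - have bj : 0 < b j by nra.
    by rewrite ltxx hh gtr0_norm // sub0r.
  have bj : b j = 0 by nra.
  by rewrite bj !mul0rn normr0 subrr oppr0.
have Fe : F e <= b e.
  have := orth_proj_edge_ge0; rewrite /F.
  by case: (S _); case: (S _); rewrite ?mulr1n ?mulr0n; lra.
rewrite (bigD1 e) //= (bigD1 j) //= -/(F e) -/(F j) Fj.
set rest := \sum_(_ | _) _.
have : rest <= 0 by apply: sumr_le0 => i /andP[/Fle].
by lra.
Qed.

Lemma foster_orth_proj : foster e = b e.
Proof.
apply/le_anti/andP; split.
  apply: bigmax_le => [|j _]; first exact: orth_proj_edge_ge0.
  exact: orth_proj_edge_max.
by apply: le_trans (ler_norm _) _; exact: (le_bigmax _ (fun j => `|b j|)).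
Qed.

Lemma chain_norm_orth_proj_edge :
  chain_norm (orth_proj (edge_chain e)) = Num.sqrt (len e * foster e).
Proof. by rewrite foster_orth_proj mulrC -inner_orth_proj_edge. Qed.

End Foster.
End Projection.

(** * Affine lifts of a segment *)

Section Lift.
Context {R : realType}.
Variable G : wgraph R.

(** The base vertex changes to the head of [e] at [t = len e]; there the whole
    of [e] is part of the integral chain instead of being a stub. *)
Lemma abel_jacobi_segment (p : point G) (e : edge G) (c : ichain G) t :
  dstar c = vertex_indic (tail e) - vertex_indic (base_vertex p) ->
  0 <= t <= len e ->
  abel_jacobi p (segment e t) =
  jac_class (int_chain (realchain c - stub p) +
             (t / len e) *: int_chain (edge_chain e)).
Proof.
move=> dc /andP[t0 tl]; rewrite /segment -linearZ -linearD /=.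
case: insubP => [u _ ut | /= tN].
  rewrite (@abel_jacobiE _ _ p (inr u) c) /= ut //.
  by rewrite addrAC addrA.
case: ifP => [t_le0 | /negbT].
  have -> : t = 0 by apply/le_anti; rewrite t_le0.
  rewrite mul0r scale0r addr0 (@abel_jacobiE _ _ p (inl (tail e)) c) //=.
  by rewrite add0r.
rewrite -ltNge => t_gt0; rewrite t_gt0 -leNgt in tN.
have -> : t = len e by apply/le_anti; rewrite tl.
rewrite divff ?gt_eqF ?len_gt0 // scale1r.
rewrite (@abel_jacobiE _ _ p (inl (head e)) (c + dart_chain (e, true))) /=.
  by rewrite realchainD realchain_dart_chain sub0r addrAC.
by rewrite dstarD dc dstar_dart_chain addrC subrKA.
Qed.

Lemma affine_lift_exists (p : point G) (e : edge G) :
  exists v, affine_lift p e v (v + int_chain (edge_chain e)).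
Proof.
have [c dc] := bounding_chain (base_vertex p) (tail e).
exists (int_chain (realchain c - stub p)) => t te.
by rewrite (abel_jacobi_segment dc te) addrAC subrr add0r.
Qed.

(** A discreteness argument by divisibility: [u] is the period of an integral
    cycle [c], and as [u / n] is a period too, [c] is divisible by every
    positive integer [n], hence zero. *)
Lemma period_lattice_no_segment (u : Omega_dual G) :
  (forall s : R, 0 <= s <= 1 -> s *: u \in period_lattice (G := G)) -> u = 0.
Proof.
move=> uL.
have /asboolP[c [c0 uc]] : u \in period_lattice (G := G).
  by rewrite -[u]scale1r uL // ler01 lexx.
have divc n : (0 < n)%N -> exists d : ichain G, forall e, c e = d e *+ n.
  move=> n0; have nR : (n%:R : R) != 0 by rewrite pnatr_eq0 -lt0n.
  have /asboolP[d [d0 ud]] : n%:R^-1 *: u \in period_lattice (G := G).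
    by rewrite uL // invr_ge0 ler0n invf_le1 ?ltr0n // ler1n.
  exists d => e.
  have cdH : n%:R *: realchain d - realchain c \in H1 G.
    by rewrite memvB ?memvZ ?realchain_H1.
  have /(int_chain_eq0 cdH)/subr0_eq/ffunP/(_ e) :
      int_chain (n%:R *: realchain d - realchain c) = 0.
    by rewrite int_chainB int_chainZ -ud -uc scalerA divff // scale1r subrr.
  rewrite !ffunE /GRing.scale /= mulr_natl -rmorphMn /=.
  by move/eqP; rewrite eqr_int => /eqP.
have c_eq0 : c = 0.
  apply/ffunP => e; rewrite ffunE; have [d /(_ e) ce] := divc `|c e|.+1 isT.
  (* A nonzero multiple of |c e| + 1 is larger than |c e|. *)
  apply: contra_eq (congr1 absz ce) => cN0.
  rewrite -mulr_natr abszM natz absz_nat.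
  rewrite neq_ltn; apply/orP; left.
  rewrite (leq_trans (ltnSn _)) // leq_pmull // absz_gt0.
  by apply: contraNneq cN0 => d0; rewrite ce d0 mul0rn.
by rewrite uc c_eq0 realchain0 int_chain0.
Qed.

Lemma affine_lift_unique (p : point G) (e : edge G) (v v' w w' : Omega_dual G) :
  affine_lift p e v v' -> affine_lift p e w w' -> v' - v = w' - w.
Proof.
move=> vP wP; apply/subr0_eq/period_lattice_no_segment => s /andP[s0 s1].
have diff (x : R) : 0 <= x <= 1 ->
    (v + x *: (v' - v)) - (w + x *: (w' - w)) \in period_lattice (G := G).
  case/andP=> x0 x1.
  have te : 0 <= x * len e <= len e.
    have l0 := len_gt0 e.
    by rewrite mulr_ge0 ?(ltW l0) // -{2}[len e]mul1r ler_wpM2r // ltW.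
  have := vP _ te; rewrite -(wP _ te) mulfK ?gt_eqF ?len_gt0 //.
  by move/eqP; rewrite -Quotient.idealrBE.
(* Comparing with s = 0 removes the starting points v and w. *)
have -> : s *: (v' - v - (w' - w)) =
    ((v + s *: (v' - v)) - (w + s *: (w' - w))) -
    ((v + 0 *: (v' - v)) - (w + 0 *: (w' - w))).
  rewrite !scale0r !addr0 scalerBr; set A := s *: _; set B := s *: _.
  by rewrite (opprD w B) addrACA [RHS]addrC addKr.
by rewrite rpredB ?diff ?s0 ?lexx ?ler01.
Qed.

End Lift.

Theorem theorem5p10 (R : realType) (G : wgraph R) (p : point G) (e : edge G) :
  (exists v v' : Omega_dual G, affine_lift p e v v') /\
  (forall v v' : Omega_dual G, affine_lift p e v v' ->
     dual_norm (v' - v) = Num.sqrt (len e * foster e)).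
Proof.
have [v vP] := affine_lift_exists p e.
split=> [|w w' wP]; first by exists v, (v + int_chain (edge_chain e)).
rewrite (affine_lift_unique wP vP) addrAC subrr add0r.
by rewrite dual_norm_int_chain chain_norm_orth_proj_edge.
Qed.
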